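(* Let $\ell \geq 1$ be an integer and let $n = 2\ell+1$. Then $SP(n,2) = \binom{n-1}{\ell-1}$. In addition, equality holds (that is, a Sperner $2$-partition system on an $n$-set has exactly $\binom{n-1}{\ell-1}$ partitions) if and only if each partition in the system has one class of size $\ell$ and the other class of size $\ell+1$.
   Context: A $k$-partition of a finite set $X$ is a collection of exactly $k$ pairwise disjoint non-empty subsets of $X$ (called classes) whose union is $X$. A Sperner $k$-partition system on $X$ is a set of $k$-partitions of $X$ such that no class of any partition in the set is a subset of (in particular, equal to) a class of another partition in the set. $SP(n,k)$ denotes the maximum number of partitions in a Sperner $k$-partition system on a set of $n$ elements.
   Formalization: The ''if'' half of the equality clause is false as stated (a single partition with classes of sizes 2 and 3 when n = 5); the formal version also requires the system to have the most partitions among Sperner systems with class sizes ℓ and ℓ+1. *)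

(* Defs.v *)
From mathcomp Require Import all_boot.
Set Implicit Arguments.
Unset Strict Implicit.
Unset Printing Implicit Defensive.

Definition kpartition (X : finType) (k : nat) (P : {set {set X}}) : bool :=
  partition P [set: X] && (#|P| == k).

Definition sperner_system (X : finType) (k : nat) (S : {set {set {set X}}}) :
    bool :=
  [forall P in S, kpartition k P] &&
  [forall P in S, forall Q in S, (P != Q) ==>
     [forall A in P, forall B in Q, ~~ (A \subset B)]].

(* The maximum is over a nonempty family, as the empty system is Sperner. *)
Definition SP (n k : nat) : nat :=
  \max_(S : {set {set {set 'I_n}}} | sperner_system k S) #|S|.

Definition split_sizes (X : finType) (a b : nat) (P : {set {set X}}) : Prop :=
  exists A B : {set X}, P = [set A; B] /\ #|A| = a /\ #|B| = b.

(* Says nothing about #|S|: the empty system satisfies it vacuously, so a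
   characterization of the systems of maximum size by their class sizes has
   to ask in addition for maximality among the systems with these sizes. *)
Definition all_split_sizes (X : finType) (a b : nat)
    (S : {set {set {set X}}}) : Prop :=
  forall P, P \in S -> split_sizes a b P.

(* Main.v *)
Require Import Defs.
From mathcomp Require Import all_boot zify.
Set Implicit Arguments.
Unset Strict Implicit.
Unset Printing Implicit Defensive.

(** With [#|X| = 2 * l + 1], exactly one class of a 2-partition [{A, ~: A}] has
    at most [l] elements, so a system [S] is encoded by the family [F] of its
    small classes.  The Sperner condition says that [F] is an antichain
    ([A] is not inside [B]) and that it is intersecting ([A] is not inside
    [~: B], and [A] meets itself because it is non-empty).  The theorem thus
    reduces to an Erdős–Ko–Rado bound for intersecting antichains of sets of
    size at most [l], where [2 * l <= #|X|]:
    [#|F| <= 'C(#|X| - 1, l - 1)], with equality only if all sizes are [l]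
    ([leq_card_intersecting_antichain]).

    The bound is proved by Katona's cycle method.  Lay out the [n] elements of
    [X] on a cycle in all [M] possible ways.  On a given cycle, at most [l] arcs
    are members of [F] ([leq_card_circ_arcs]): fix one of them, [A0]; every
    other one has either its start or its end at one of the inner gaps of [A0],
    and each of the at most [l - 1] gaps is used at most once.  Conversely, a
    member [A] of [F] is the arc with a prescribed start for exactly
    [M %/ 'C(n, #|A|)] layouts ([card_layouts_imset]).  Counting the triples
    (layout, start, member) in both ways gives
    [n * \sum_(A in F) M %/ 'C(n, #|A|) <= l * M].  As ['C(n, a)] increases
    strictly for [a <= l], replacing every [#|A|] by [l] gives the bound, and
    loses something unless all sizes are [l].

    The bound is attained by the star, made of the partitions whose class
    containing a fixed point has [l] elements; as the star has the sizes [l]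
    and [l + 1], a system that is maximum among those with these sizes also
    attains the bound. *)

(** * Arcs on a cycle *)

(** The arc of length [a] starting at [i] on the cycle ['I_n], described by
    linear inequalities instead of a remainder modulo [n]: the second disjunct
    is the part that wraps around. *)
Definition circ_arc (n : nat) (i : 'I_n) (a : nat) : {set 'I_n} :=
  [set x : 'I_n | (i <= x < i + a) || (x + n < i + a)].

Lemma card_circ_arc n (i : 'I_n) a : a <= n -> #|circ_arc i a| = a.
Proof.
move=> le_an.
pose h (k : 'I_a) : 'I_n := insubd i (if i + k < n then i + k else i + k - n).
have hE k : h k = (if i + k < n then i + k else i + k - n) :> nat.
  rewrite val_insubd; have := ltn_ord i; have := ltn_ord k.
  by case: ifP; case: ifP; lia.
have h_inj : injective h.
  move=> j k /(congr1 val); rewrite /= !hE => ejk; apply: val_inj => /=.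
  have := ltn_ord i; have := ltn_ord k; have := ltn_ord j.
  by move: ejk; case: ifP; case: ifP; lia.
suff -> : circ_arc i a = [set h k | k : 'I_a] by rewrite card_imset // card_ord.
apply/setP => x; rewrite inE; apply/idP/imsetP => [x_arc | [k _ ->]].
  have lt_k : (if i <= x then x - i else x + n - i) < a.
    by have := ltn_ord i; case: ifP; lia.
  exists (Ordinal lt_k) => //; apply: val_inj; rewrite /= hE /=.
  have := ltn_ord i; have := ltn_ord x.
  by case: (leqP i x) => ?; case: ifP; lia.
rewrite hE; have := ltn_ord i; have := ltn_ord k.
by case: ifP; lia.
Qed.

(** If [i] were another point of the arc starting at [j], the last point of the
    arc starting at [i] would lie beyond the end of the arc starting at [j],
    without reaching [j] again, as both lengths are at most half the cycle. *)
Lemma circ_arc_sub_start n (i j : 'I_n) a :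
  0 < a -> 2 * a <= n -> circ_arc i a \subset circ_arc j a -> i = j.
Proof.
move=> a_gt0 le_2an /subsetP sub_ij; apply: val_inj => /=.
have lt_in := ltn_ord i; have lt_jn := ltn_ord j.
have i_arc : i \in circ_arc j a by apply: sub_ij; rewrite inE; lia.
have lt_e : (if i + a <= n then i + a - 1 else i + a - 1 - n) < n.
  by case: ifP; lia.
have e_arc : Ordinal lt_e \in circ_arc j a.
  by apply: sub_ij; rewrite inE /=; case: ifP; lia.
by move: i_arc e_arc; rewrite !inE /=; case: ifP; lia.
Qed.

(** Katona's lemma, in the form for arcs of different lengths.  Fix an arc [p0]
    of the family.  To each arc [p] associate the offset, inside the arc of
    [p0], of the start of [p] if it lies there, and of the end of [p] otherwise.
    This is injective into an interval of size [len p0 <= l]: two arcs with the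
    same start, or the same end, are nested, and an arc ending where another one
    starts is disjoint from it because their lengths add up to at most [n]. *)
Lemma leq_card_circ_arcs n l (K : finType) (G : {set K}) (start : K -> 'I_n)
    (len : K -> nat) :
  2 * l <= n -> {in G, forall p, len p <= l} ->
  {in G &, forall p q,
     circ_arc (start p) (len p) \subset circ_arc (start q) (len q) -> p = q} ->
  {in G &, forall p q,
     circ_arc (start p) (len p) :&: circ_arc (start q) (len q) != set0} ->
  #|G| <= l.
Proof.
move=> le_2ln le_len antichain meet.
case: (set_0Vmem G) => [-> | [p0 Gp0]]; first by rewrite cards0.
have meetE p q : p \in G -> q \in G -> exists2 x : 'I_n,
    x \in circ_arc (start p) (len p) & x \in circ_arc (start q) (len q).
  by move=> Gp Gq; have /set0Pn[x /setIP[]] := meet p q Gp Gq; exists x.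
pose i0 : nat := start p0.
have lt_i0 : i0 < n := ltn_ord _.
(* Distance from [i0] to [y] along the cycle, for [y < 2 * n]. *)
pose off y := if y < i0 then y + n - i0
              else if y < i0 + n then y - i0 else y - n - i0.
pose h p := if off (start p) < len p0 then off (start p)
            else off (start p + len p).
have h_lt p : p \in G -> h p < len p0.
  move=> Gp; rewrite /h; case: ifP => // out.
  have [x] := meetE p p0 Gp Gp0.
  have lt_in := ltn_ord (start p); have le_p := le_len _ Gp.
  have le_p0 := le_len _ Gp0; have lt_xn := ltn_ord x.
  rewrite !inE => xp xp0.
  (* [p] starts outside the arc of [p0] and meets it, so it enters from the
     left; it stops before the end of that arc, which it would otherwise
     contain. *)
  have /subsetPn[y] :
      ~~ (circ_arc (start p0) (len p0) \subset circ_arc (start p) (len p)).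
    apply/negP => /(antichain _ _ Gp0 Gp) eq_p; move: out xp0.
    by rewrite -eq_p /off -/i0 ltnn; case: ifP; lia.
  have lt_yn := ltn_ord y.
  rewrite !inE -/i0; rewrite -/i0 in xp0; move: out xp xp0.
  by rewrite /off; do !case: ifP; lia.
have h_inj : {in G &, injective h}.
  move=> p q Gp Gq.
  have lt_pn := ltn_ord (start p); have le_p := le_len _ Gp.
  have lt_qn := ltn_ord (start q); have le_q := le_len _ Gq.
  have [x xp xq] := meetE p q Gp Gq.
  have le_p0 := le_len _ Gp0; have lt_xn := ltn_ord x.
  have := h_lt p Gp; have := h_lt q Gq.
  rewrite /h; case: ifP => inq; case: ifP => inp => ltq ltp eqh.
  - have eqs : start p = start q :> nat.
      by move: eqh; rewrite /off; do !case: ifP; lia.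
    case/orP: (leq_total (len p) (len q)) => le_pq.
      by apply: antichain => //; apply/subsetP => y; rewrite !inE; lia.
    by apply/esym/antichain => //; apply/subsetP => y; rewrite !inE; lia.
  (* Here one arc starts where the other ends, against their meeting at [x]. *)
  - by move: xp xq eqh inp inq ltp ltq; rewrite !inE /off; do !case: ifP; lia.
  - by move: xp xq eqh inp inq ltp ltq; rewrite !inE /off; do !case: ifP; lia.
  (* The ends are compared before reduction modulo [n]. *)
  have eqe : [\/ start p + len p = start q + len q,
     start p + len p = start q + len q + n |
     start p + len p + n = start q + len q].
    have [|ne1] := eqVneq (start p + len p) (start q + len q).
      by constructor 1.
    have [|ne2] := eqVneq (start p + len p) (start q + len q + n).
      by constructor 2.
    by constructor 3; move: eqh; rewrite /off; do !case: ifP; lia.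
  case/orP: (leq_total (len p) (len q)) => le_pq.
    apply: antichain => //; apply/subsetP => y; have lt_yn := ltn_ord y.
    by rewrite !inE; case: eqe; lia.
  apply/esym/antichain => //; apply/subsetP => y; have lt_yn := ltn_ord y.
  by rewrite !inE; case: eqe; lia.
apply: leq_trans (le_len _ Gp0).
rewrite cardE -(size_map h) -(size_iota 0 (len p0)).
apply: uniq_leq_size.
  rewrite map_inj_in_uniq ?enum_uniq // => p q.
  by rewrite !mem_enum; apply: h_inj.
move=> _ /mapP[p Gp ->]; rewrite mem_iota add0n h_lt //.
by rewrite mem_enum in Gp.
Qed.

(** * Cyclic layouts of a finite set *)

(** The map sends the list of [A] followed by its complement, entry by entry, to
    the same list for [B]. *)
Lemma exists_inj_imset (X : finType) (A B : {set X}) :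
  #|A| = #|B| -> exists2 t : X -> X, injective t & t @: A = B.
Proof.
move=> eqAB.
pose s (C : {set X}) := enum C ++ enum (~: C).
have s_uniq C : uniq (s C).
  rewrite cat_uniq !enum_uniq andbT /=; apply/hasPn => x.
  by rewrite !mem_enum inE.
have mem_s C x : x \in s C by rewrite mem_cat !mem_enum inE orbN.
have size_s C : size (s C) = #|X| by rewrite size_cat -!cardE cardsC.
have index_lt x : index x (s A) < size (s B).
  by rewrite size_s -(size_s A) index_mem.
pose t x := nth x (s B) (index x (s A)).
have t_inj : injective t.
  move=> x y; rewrite /t (set_nth_default y) // => /eqP.
  by rewrite nth_uniq // => /eqP; apply: index_inj.
exists t => //.
apply/eqP; rewrite eqEcard card_imset // eqAB leqnn andbT.
apply/subsetP => _ /imsetP[x Ax ->].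
rewrite /t index_cat mem_enum Ax nth_cat -cardE -eqAB cardE index_mem
  mem_enum Ax.
by rewrite -mem_enum mem_nth // -cardE -eqAB cardE index_mem mem_enum.
Qed.

Definition layouts (X : finType) (n : nat) : {set {ffun 'I_n -> X}} :=
  [set f : {ffun 'I_n -> X} | injectiveb f].

Lemma layouts_gt0 (X : finType) : 0 < #|layouts X #|X| |.
Proof.
apply/card_gt0P; exists [ffun i => enum_val i]; rewrite inE.
by apply/injectiveP => i j; rewrite !ffunE => /enum_val_inj.
Qed.

(** Classify the layouts [f] by the set [f @: P].  All ['C(#|X|, #|A|)] sets of
    the size of [P] occur equally often, because composing with a permutation of
    [X] that maps [B] to [C] turns layouts sending [P] to [B] into layouts
    sending [P] to [C]. *)
Lemma card_layouts_imset (X : finType) n (P : {set 'I_n}) (A : {set X}) :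
  #|P| = #|A| ->
  #|[set f in layouts X n | f @: P == A]| * 'C(#|X|, #|A|) = #|layouts X n|.
Proof.
move=> eqPA; pose N (B : {set X}) := #|[set f in layouts X n | f @: P == B]|.
have N_le (B C : {set X}) : #|B| = #|C| -> N B <= N C.
  case/exists_inj_imset=> t t_inj tBC.
  pose post (f : {ffun 'I_n -> X}) := [ffun i => t (f i)].
  have post_inj : injective post.
    move=> f g /ffunP eq_fg; apply/ffunP => i.
    by have := eq_fg i; rewrite !ffunE => /t_inj.
  rewrite /N -(card_imset _ post_inj); apply/subset_leq_card/subsetP.
  move=> _ /imsetP[f + ->]; rewrite !inE => /andP[/injectiveP f_inj /eqP fPB].
  apply/andP; split.
    by apply/injectiveP => i j; rewrite !ffunE => /t_inj/f_inj.
  by rewrite -tBC -fPB -imset_comp; apply/eqP/eq_imset => i; rewrite ffunE.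
rewrite -[RHS]sum1_card -/(N A).
rewrite [RHS](partition_big (fun f : {ffun 'I_n -> X} => f @: P)
                (mem [set B : {set X} | #|B| == #|A|])) /=; last first.
  by move=> f; rewrite !inE => /injectiveP f_inj; rewrite card_imset // eqPA.
rewrite [RHS](eq_bigr (fun=> N A)) => [|B].
  by rewrite sum_nat_const card_draws mulnC.
rewrite inE => /eqP eqBA; transitivity (N B).
  by rewrite /N -sum1_card; apply: eq_bigl => f; rewrite !inE.
by apply/eqP; rewrite eqn_leq !N_le.
Qed.

(** * Intersecting antichains of small sets *)

Lemma ltn_bin_half n a l : a < l -> 2 * l <= n -> 'C(n, a) < 'C(n, l).
Proof.
elim: l => // l IHl; rewrite ltnS leq_eqVlt => /predU1P[->|lt_al] le_ln.
  have := mul_bin_left n l; have : 0 < 'C(n, l) by rewrite bin_gt0; lia.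
  nia.
apply: ltn_trans (IHl lt_al _) _; first by lia.
have := mul_bin_left n l; have : 0 < 'C(n, l) by rewrite bin_gt0; lia.
nia.
Qed.

Section IntersectingAntichain.
Variables (X : finType) (F : {set {set X}}) (l : nat).
Hypotheses (le_2l : 2 * l <= #|X|)
  (le_card : {in F, forall A : {set X}, #|A| <= l}).
Hypothesis antichain : {in F &, forall A B : {set X}, A \subset B -> A = B}.
Hypothesis meet : {in F &, forall A B : {set X}, A :&: B != set0}.

Let n := #|X|.
Let M := #|layouts X n|.
(** The number of layouts for which [A] is the arc with a prescribed start. *)
Let wt (A : {set X}) := M %/ 'C(n, #|A|).

Let binX_gt0 (A : {set X}) : 0 < 'C(n, #|A|).
Proof. by rewrite bin_gt0 max_card. Qed.

Lemma leq_card_layout_arcs (f : {ffun 'I_n -> X}) : injective f ->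
  #|[set p : 'I_n * {set X} | (p.2 \in F) && (f @: circ_arc p.1 #|p.2| == p.2)]|
    <= l.
Proof.
move=> f_inj; pose len (p : 'I_n * {set X}) := #|p.2|.
apply: (@leq_card_circ_arcs n l _ _ fst len le_2l)
  => [[i A]|[i A] [j B]|[i A] [j B]]; rewrite !inE /len /=.
- by case/andP=> /le_card.
- move=> /andP[FA /eqP iA] /andP[FB /eqP jB] sub_ij.
  have eqAB : A = B by apply: antichain => //; rewrite -iA -jB imsetS.
  rewrite -eqAB in sub_ij *; congr (_, _); apply: circ_arc_sub_start sub_ij.
    by rewrite card_gt0 -(setIid A) meet.
  by rewrite (leq_trans _ le_2l) // leq_mul2l le_card.
move=> /andP[FA /eqP iA] /andP[FB /eqP jB].
have := meet FA FB; rewrite -{1}iA -{1}jB -imsetI ?imset_eq0 //.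
by move=> x y _ _; apply: f_inj.
Qed.

(** Double counting of the triples of a layout, a start and a member [A] of [F]
    such that [A] is the arc of length [#|A|] from this start. *)
Lemma leq_sum_wt : n * (\sum_(A in F) wt A) <= l * M.
Proof.
pose G (f : {ffun 'I_n -> X}) :=
  [set p : 'I_n * {set X} | (p.2 \in F) && (f @: circ_arc p.1 #|p.2| == p.2)].
have -> : n * (\sum_(A in F) wt A) = \sum_(f in layouts X n) #|G f|.
  rewrite -[n in n * _]card_ord -sum_nat_const pair_big /=.
  under [RHS]eq_bigr do rewrite -sum1_card big_mkcond.
  rewrite exchange_big /= big_mkcond; apply: eq_bigr => -[i A] _ /=.
  under eq_bigr do rewrite inE /=.
  case: (A \in F) => /=; last by rewrite big1.
  rewrite -big_mkcondr sum1dep_card /wt /M.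
  have le_A : #|A| <= n := max_card _.
  by rewrite -(card_layouts_imset (card_circ_arc i le_A)) mulnK ?binX_gt0.
rewrite mulnC -sum_nat_const; apply: leq_sum => f.
by rewrite inE => /injectiveP; apply: leq_card_layout_arcs.
Qed.

Hypothesis l_gt0 : 0 < l.

(** The weight is smallest at the largest size [l], where ['C(n, a)] is largest;
    multiplying by ['C(n, l)] clears the denominator. *)
Let leqif_wt A : A \in F -> M <= wt A * 'C(n, l) ?= iff (#|A| == l).
Proof.
move=> FA; have M_gt0 : 0 < M := layouts_gt0 X.
have defM : wt A * 'C(n, #|A|) = M.
  have le_A : #|A| <= n := max_card _.
  have i0 : 'I_n by exists 0; rewrite /n; lia.
  by rewrite /wt /M -(card_layouts_imset (card_circ_arc i0 le_A)) mulnK.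
have wt_gt0 : 0 < wt A by move: M_gt0; rewrite -defM muln_gt0 => /andP[].
rewrite -{1}defM; have := le_card FA; rewrite leq_eqVlt => /predU1P[->|lt_Al].
  by rewrite eqxx; apply/leqif_refl.
have lt_bin := ltn_bin_half lt_Al le_2l.
split; first by rewrite leq_mul2l ltnW ?orbT.
by rewrite eqn_pmul2l // (ltn_eqF lt_bin) (ltn_eqF lt_Al).
Qed.

(** An Erdős–Ko–Rado theorem for antichains.  It follows from [leq_sum_wt]
    multiplied by ['C(n, l)], since [l * 'C(n, l) = n * 'C(n - 1, l - 1)]. *)
Lemma leq_card_intersecting_antichain :
  #|F| <= 'C(#|X| - 1, l - 1) /\
  (#|F| = 'C(#|X| - 1, l - 1) -> {in F, forall A : {set X}, #|A| = l}).
Proof.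
have M_gt0 : 0 < M := layouts_gt0 X.
have n_gt0 : 0 < n by rewrite /n; lia.
have sum_le : \sum_(A in F) wt A * 'C(n, l) <= 'C(n - 1, l - 1) * M.
  rewrite -big_distrl /= -(leq_pmul2l n_gt0) mulnA [n * ('C(_, _) * _)]mulnA.
  rewrite !subn1 mul_bin_diag prednK //.
  by rewrite [l * _ * M]mulnAC leq_mul2r leq_sum_wt orbT.
have leif_sum := leqif_sum leqif_wt.
rewrite sum_nat_const in leif_sum.
have le_sum := leq_trans leif_sum sum_le.
split=> [|eqF A FA]; first by rewrite leq_pmul2r in le_sum.
have : [forall (A | A \in F), #|A| == l].
  by rewrite -leif_sum eqn_leq leif_sum /= eqF.
by move/forall_inP/(_ A FA)/eqP.
Qed.
End IntersectingAntichain.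

(** * Sperner 2-partition systems *)

Lemma kpartition2P (X : finType) (P : {set {set X}}) :
  reflect (exists A : {set X}, [/\ A != set0, ~: A != set0 & P = [set A; ~: A]])
          (kpartition 2 P).
Proof.
apply: (iffP andP) => [[partP /cards2P[A [B [neqAB defP]]]] | [A [A0 A'0 ->]]].
  have [/eqP coverP trivP P0] := and3P partP.
  have dAB : [disjoint A & B].
    by move/trivIsetP: trivP; apply; rewrite // defP !inE eqxx ?orbT.
  have defB : B = ~: A.
    apply/eqP; rewrite eqEsubset -disjoints_subset disjoint_sym dAB /=.
    apply/subsetP => x; rewrite inE => /negbTE xA.
    by have := in_setT x; rewrite -coverP defP /cover
      bigcup_setU !big_set1 inE xA.
  exists A; rewrite -defB; split=> //; apply: contraNneq P0 => <-;
    by rewrite defP !inE eqxx ?orbT.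
have neqA : A != ~: A.
  have /set0Pn[x Ax] := A0.
  by apply/eqP => /setP/(_ x); rewrite inE Ax.
split; last by rewrite cards2 neqA.
apply/and3P; split.
- by rewrite /cover bigcup_setU !big_set1 setUCr.
- apply/trivIsetP => B C; rewrite !inE.
  by case/orP=> /eqP-> /orP[]/eqP->; rewrite ?eqxx // disjoints_subset ?setCK.
by rewrite !inE !(eq_sym set0) (negbTE A0) (negbTE A'0).
Qed.

Lemma sperner_systemP (X : finType) k (S : {set {set {set X}}}) :
  reflect ({in S, forall P : {set {set X}}, kpartition k P} /\
           {in S &, forall (P Q : {set {set X}}) (A B : {set X}),
              A \in P -> B \in Q -> A \subset B -> P = Q})
          (sperner_system k S).
Proof.
apply: (iffP andP) => [[/forall_inP kS /forall_inP spS] | [kS spS]].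
  split=> // P Q SP SQ A B PA QB subAB; apply/eqP/negPn/negP => neqPQ.
  have /forall_inP/(_ _ SQ)/implyP/(_ neqPQ) := spS _ SP.
  by move=> /forall_inP/(_ _ PA)/forall_inP/(_ _ QB)/negP.
split; first exact/forall_inP.
apply/forall_inP => P SP; apply/forall_inP => Q SQ; apply/implyP => neqPQ.
apply/forall_inP => A PA; apply/forall_inP => B QB.
by apply: contra neqPQ => subAB; apply/eqP/(spS P Q SP SQ A B).
Qed.

Section SmallClasses.
Variables (X : finType) (l : nat).
Hypothesis cardX : #|X| = 2 * l + 1.

Definition small_classes (S : {set {set {set X}}}) : {set {set X}} :=
  [set A : {set X} | (#|A| <= l) && ([set A; ~: A] \in S)].

Lemma card_compl (A : {set X}) : #|~: A| = 2 * l + 1 - #|A|.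
Proof. by rewrite -cardX -(cardsC A) addKn. Qed.

(** The complement of a set of size at most [l] has more than [l] elements, so
    it cannot be the small class of the other pair. *)
Lemma eq_small_pair (A B : {set X}) :
  #|A| <= l -> #|B| <= l -> [set A; ~: A] = [set B; ~: B] -> A = B.
Proof.
move=> leA leB /setP/(_ A); rewrite !inE eqxx => /esym/orP[/eqP //|/eqP defA].
by have := card_compl B; rewrite -defA; lia.
Qed.

Lemma card_small_classes (S : {set {set {set X}}}) :
  sperner_system 2 S -> #|small_classes S| = #|S|.
Proof.
case/sperner_systemP=> kS _.
pose pair (A : {set X}) := [set A; ~: A].
have pair_inj : {in small_classes S &, injective pair}.
  move=> A B; rewrite !inE => /andP[leA _] /andP[leB _].
  exact: eq_small_pair.
rewrite -(card_in_imset pair_inj); apply: eq_card => P.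
apply/imsetP/idP => [[A + ->] | SP]; first by rewrite inE => /andP[].
have /kpartition2P[A [_ _ defP]] := kS P SP.
have [leA | ltA] := leqP #|A| l.
  by exists A; rewrite // inE leA -defP.
exists (~: A); rewrite /pair ?inE setCK setUC -defP // SP andbT card_compl.
by lia.
Qed.

(** Excluding [A \subset B] makes the small classes an antichain, and excluding
    [A \subset ~: B] makes them intersecting; both need that distinct small
    classes belong to distinct partitions, which is [eq_small_pair]. *)
Lemma sperner2_leq (S : {set {set {set X}}}) : 0 < l -> sperner_system 2 S ->
  #|S| <= 'C(2 * l, l - 1) /\
  (#|S| = 'C(2 * l, l - 1) -> all_split_sizes l (l + 1) S).
Proof.
move=> l_gt0 spS; have [kS sepS] := sperner_systemP _ _ spS.
have smallP A : A \in small_classes S -> [/\ #|A| <= l, [set A; ~: A] \in S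
    & A != set0].
  rewrite inE => /andP[leA SA]; split=> //; apply/eqP => A0.
  have /kpartition2P[B [B0 B'0 /setP/(_ set0)]] := kS _ SA.
  by rewrite !inE A0 eqxx !(eq_sym set0) (negbTE B0) (negbTE B'0).
have [] := @leq_card_intersecting_antichain X (small_classes S) l.
- by rewrite cardX leq_addr.
- by move=> A /smallP[].
- move=> A B /smallP[leA SA _] /smallP[leB SB _] subAB.
  apply: eq_small_pair => //.
  by apply: (sepS _ _ SA SB A B); rewrite ?set21.
- move=> A B /smallP[leA SA A0] /smallP[leB SB _].
  apply/negP; rewrite setI_eq0 disjoints_subset => subAB.
  have eqAB : A = B.
    apply: eq_small_pair => //.
    by apply: (sepS _ _ SA SB A (~: B)); rewrite ?set21 ?set22.
  have /set0Pn[x Ax] := A0.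
  by have /subsetP/(_ x Ax) := subAB; rewrite -eqAB inE Ax.
- by [].
rewrite card_small_classes // cardX addnK => le_S eq_S; split=> // eqS P SP.
have : P \in [set [set A; ~: A] | A in small_classes S].
  have /kpartition2P[A [_ _ defP]] := kS P SP.
  apply/imsetP; have [leA | ltA] := leqP #|A| l.
    by exists A; rewrite // inE leA -defP.
  exists (~: A); rewrite ?inE setCK setUC -defP // SP andbT card_compl.
  by lia.
case/imsetP=> A FA ->; exists A, (~: A); rewrite card_compl (eq_S eqS A FA).
by do !split; lia.
Qed.

Definition star_system (x0 : X) : {set {set {set X}}} :=
  [set [set A; ~: A] | A in [set A : {set X} | (x0 \in A) && (#|A| == l)]].

(** Among the inclusions between classes of two partitions, those between
    classes of equal size force equality, [A \subset ~: B] fails at [x0], and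
    [~: A \subset B] fails by size. *)
Lemma star_system_sperner (x0 : X) : sperner_system 2 (star_system x0).
Proof.
apply/sperner_systemP; split=> [_ /imsetP[A + ->] | ].
  rewrite inE => /andP[Ax0 /eqP cA]; apply/kpartition2P; exists A.
  have : 0 < #|A| by apply/card_gt0P; exists x0.
  by rewrite -!card_gt0 card_compl cA => l_gt0; split=> //; lia.
move=> _ _ /imsetP[A + ->] /imsetP[B + ->] C D.
rewrite !inE => /andP[Ax0 /eqP cA] /andP[Bx0 /eqP cB].
have eqAB : A \subset B -> A = B.
  by move=> sAB; apply/eqP; rewrite eqEcard sAB cA cB /=.
have eqBA : B \subset A -> A = B.
  by move=> sBA; apply/esym/eqP; rewrite eqEcard sBA cA cB /=.
case/orP=> /eqP-> /orP[]/eqP->.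
- by move/eqAB->.
- by move/subsetP/(_ x0 Ax0); rewrite inE Bx0.
- by move/subset_leq_card; rewrite card_compl cA cB; lia.
by rewrite setCS => /eqBA->.
Qed.

Lemma star_system_split (x0 : X) : all_split_sizes l (l + 1) (star_system x0).
Proof.
move=> _ /imsetP[A + ->]; rewrite inE => /andP[_ /eqP cA].
by exists A, (~: A); rewrite card_compl cA; do !split; lia.
Qed.

(** Removing [x0] identifies the [l]-sets containing [x0] with the
    [(l - 1)]-sets of the other [2 * l] points. *)
Lemma card_star_system (x0 : X) : 0 < l ->
  #|star_system x0| = 'C(2 * l, l - 1).
Proof.
move=> l_gt0; rewrite card_in_imset; last first.
  move=> A B; rewrite !inE => /andP[_ /eqP cA] /andP[_ /eqP cB].
  by apply: eq_small_pair; rewrite ?cA ?cB.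
have -> : 2 * l = #|[set~ x0]| by rewrite cardsC1 cardX addn1.
rewrite -cards_draws.
have subC1 (A : {set X}) : (A \subset [set~ x0]) = (x0 \notin A).
  by rewrite -disjoints_subset disjoint_sym disjoints1.
have addx_inj :
    {in [set A : {set X} | (A \subset [set~ x0]) && (#|A| == l - 1)] &,
    injective (fun A => x0 |: A)}.
  move=> A B; rewrite !inE !subC1 => /andP[nA _] /andP[nB _] eqAB.
  by rewrite -(setU1K nA) eqAB setU1K.
rewrite -(card_in_imset addx_inj); apply: eq_card => A; rewrite inE.
apply/andP/imsetP => [[Ax0 /eqP cA] | [B + ->]].
  exists (A :\ x0); last by rewrite setD1K.
  rewrite inE subC1 setD11 /=; have := cardsD1 x0 A; rewrite Ax0 cA.
  by move=> ?; apply/eqP; lia.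
rewrite inE subC1 => /andP[nB /eqP cB].
by rewrite setU11 cardsU1 nB cB; split=> //; apply/eqP; lia.
Qed.

End SmallClasses.

Theorem theorem2p1 (l n : nat) (l_ge1 : 1 <= l) (n_def : n = 2 * l + 1) :
  SP n 2 = 'C(n - 1, l - 1) /\
  (forall (X : finType) (S : {set {set {set X}}}),
     #|X| = n -> sperner_system 2 S ->
     (#|S| = 'C(n - 1, l - 1) <->
      all_split_sizes l (l + 1) S /\
      (forall T : {set {set {set X}}},
         sperner_system 2 T -> all_split_sizes l (l + 1) T -> #|T| <= #|S|))).
Proof.
have -> : n - 1 = 2 * l by rewrite n_def addnK.
split=> [|X S cardX spS].
  have cardn : #|'I_n| = 2 * l + 1 by rewrite card_ord.
  have lt0n : 0 < n by rewrite n_def addn1.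
  apply/eqP; rewrite eqn_leq; apply/andP; split.
    by apply/bigmax_leqP => S spS; case: (sperner2_leq cardn l_ge1 spS).
  rewrite -(card_star_system cardn (Ordinal lt0n) l_ge1).
  by apply: (bigmax_sup (star_system l (Ordinal lt0n))) => //;
    apply: star_system_sperner.
rewrite n_def in cardX.
have [le_S splitS] := sperner2_leq cardX l_ge1 spS.
split=> [eqS | [_ maxS]].
  split=> [|T spT _]; first exact: splitS.
  by rewrite eqS; case: (sperner2_leq cardX l_ge1 spT).
have /card_gt0P[x0 _] : 0 < #|X| by rewrite cardX addn1.
apply/eqP; rewrite eqn_leq le_S /= -(card_star_system cardX x0 l_ge1).
by apply: maxS; [apply: star_system_sperner | apply: star_system_split].
Qed.
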